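(* Let $\mathcal{A}$ be a Banach algebra such that $\mathrm{rad}(\mathcal{A})=\mathrm{rann}(\mathcal{A})$ and $\mathcal{A}/\mathrm{rad}(\mathcal{A})$ is commutative, and suppose $\mathcal{A}$ has a right identity. Let $d$ be a derivation of $\mathcal{A}$ and $k$ a positive integer. Then the following are equivalent: (i) $d=0$; (ii) $d$ is $k$-centralizing; (iii) $d$ is $k$-commuting.
   Context: $\mathrm{rad}(\mathcal{A})$ is the Jacobson radical and $\mathrm{rann}(\mathcal{A})=\{c\in\mathcal{A}: ac=0\ \forall a\in\mathcal{A}\}$. A derivation is a linear map $d$ with $d(ab)=d(a)b+ad(b)$. $Z(\mathcal{A})$ is the algebraic center of $\mathcal{A}$ and $[a,b]=ab-ba$. A map $T:\mathcal{A}\to\mathcal{A}$ is $k$-centralizing (resp. $k$-commuting) if $[T(a),a^k]\in Z(\mathcal{A})$ (resp. $[T(a),a^k]=0$) for all $a\in\mathcal{A}$. *)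

(* Defs.v *)
From HB Require Import structures.
From mathcomp Require Import all_boot all_order all_algebra.
From mathcomp Require Import all_classical all_reals all_analysis.
From mathcomp Require Import complex.
Set Implicit Arguments. Unset Strict Implicit. Unset Printing Implicit Defensive.
Import Order.TTheory GRing.Theory Num.Theory.
Import numFieldNormedType.Exports.
Local Open Scope ring_scope.

(* A (complex, possibly non-unital) Banach algebra: a complete normed space A
   over K together with an associative bilinear multiplication `mul` whose
   norm is submultiplicative. MathComp rings are unital, so the multiplication
   is given as an explicit operation. *)
Definition banach_algebra (K : numFieldType) (A : completeNormedModType K)
  (mul : A -> A -> A) : Prop :=
  (forall x y z, mul x (mul y z) = mul (mul x y) z) /\
  (forall x y z, mul (x + y) z = mul x z + mul y z) /\
  (forall x y z, mul x (y + z) = mul x y + mul x z) /\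
  (forall (c : K) x y, mul (c *: x) y = c *: mul x y) /\
  (forall (c : K) x y, mul x (c *: y) = c *: mul x y) /\
  (forall x y, `|mul x y| <= `|x| * `|y|).

Section Defs.
Variables (K : numFieldType) (A : completeNormedModType K) (mul : A -> A -> A).

Definition lquasi_invertible (x : A) : Prop :=
  exists y : A, y + x - mul y x = 0.

(* Jacobson radical of a (possibly non-unital) algebra:
   rad(A) = { a | b a is left quasi-invertible for every b in A }. *)
Definition in_rad (a : A) : Prop := forall b : A, lquasi_invertible (mul b a).

Definition in_rann (c : A) : Prop := forall a : A, mul a c = 0.

Definition in_center (z : A) : Prop := forall a : A, mul z a = mul a z.

Definition commutator (a b : A) : A := mul a b - mul b a.

(* a^k for k >= 1 (non-unital algebra): pw a 0 = a, pw a k = a^(k+1). *)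
Fixpoint pw (a : A) (k : nat) : A :=
  match k with 0%N => a | k'.+1 => mul (pw a k') a end.
Definition powk (a : A) (k : nat) : A := pw a k.-1.

Definition derivation (d : A -> A) : Prop :=
  [/\ (forall x y, d (x + y) = d x + d y),
      (forall (c : K) x, d (c *: x) = c *: d x)
    & (forall x y, d (mul x y) = mul (d x) y + mul x (d y))].

Definition k_centralizing (k : nat) (T : A -> A) : Prop :=
  forall a, in_center (commutator (T a) (powk a k)).

Definition k_commuting (k : nat) (T : A -> A) : Prop :=
  forall a, commutator (T a) (powk a k) = 0.

End Defs.

(* Main.v *)
Require Import Defs.
From HB Require Import structures.
From mathcomp Require Import all_boot all_order all_algebra.
From mathcomp Require Import all_classical all_reals all_analysis.
From mathcomp Require Import complex.
From mathcomp Require Import cyclic separable cyclotomic ring lra.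
Import Order.TTheory GRing.Theory Num.Theory.
Import numFieldNormedType.Exports.
Import ComplexField.Normc.
Local Open Scope ring_scope.
Local Open Scope complex_scope.
Set Implicit Arguments. Unset Strict Implicit. Unset Printing Implicit Defensive.

(** Let e be a right identity. The corner eA is a closed commutative subalgebra
with identity e, it is semisimple because rad A = rann A, and A = eA + rann A.
The map x |-> e (d x) is a derivation of eA, so it vanishes by the theorem of
Johnson and Singer-Wermer, that is, d takes its values in rann A. Hence
[d a, a^k] = (d a) a^k, and this element of rann A is central only if it is 0.
If it is 0 for all a, the idempotents e and e + n with n in rann A give d e = 0
and d n = 0, so that d a = (d e) a + e (d a) + d (a - e a) = 0.

Johnson's theorem (a derivation D of a commutative semisimple unital Banach
algebra B vanishes, continuity of D not being assumed) is proved without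
characters. Let S be the separating space of D. A gliding hump shows that each
s in S has finite spectrum; by the Gelfand-Mazur theorem the polynomial with
these simple roots maps s into the radical, hence kills s, and differentiating
this relation gives D s = 0. Therefore S S = 0 and S = 0, D is bounded by the
closed graph theorem, and the Kleinecke-Shirokov identity
n! (D a)^n = ad(a)^n (D^n) shows that D a lies in the radical. *)

(** * Lipschitz functions on the complex plane *)

Section ScalarModulus.
Variable R : realType.
Implicit Types (z w : R[i]) (x y : R).

Lemma normcE z : `|z| = (normc z)%:C. Proof. by []. Qed.

Lemma normc_real x : normc x%:C = `|x|.
Proof. by rewrite /normc /= expr0n addr0 sqrtr_sqr. Qed.

Lemma normc_ge0 z : 0 <= normc z.
Proof. by rewrite -lecR -normcE normr_ge0. Qed.

Lemma normc_sub z w : normc (z - w) = normc (w - z).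
Proof. by rewrite -opprB normcN. Qed.

Lemma Re_le_normc z : `|complex.Re z| <= normc z.
Proof. by have := normc_ge_Re z; rewrite lecR. Qed.

Lemma Im_le_normc z : `|complex.Im z| <= normc z.
Proof.
have := Re_le_normc (z * 'i); rewrite ReiNIm normrN normcM => /le_trans; apply.
by rewrite /normc /= expr0n expr1n add0r sqrtr1 mulr1.
Qed.

Lemma lipschitz_continuous (g : R -> R) (a b : R) :
  (forall x y, g x <= g y + `|x - y|) -> {within `[a, b], continuous g}%classic.
Proof.
move=> Lg; apply: continuous_subspaceT => x.
apply/(@cvgrPdist_lt _ R^o) => e e0; near=> y.
have yx : `|x - y| < e.
  by near: y; apply: (@cvgr_dist_lt _ R^o _ _ _ id).
rewrite ltr_norml ltrBlDr ltrNl opprB ltrBlDr.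
rewrite (le_lt_trans (Lg x y)) 1?(le_lt_trans (Lg y x)) //= addrC ?ltrD2r //.
Unshelve. all: by end_near.
Qed.

(** The minimum over a large square comes from two uses of the one-variable extreme value theorem:
    first in the imaginary part, then for the partial minimum, which is again 1-Lipschitz. *)
Lemma coercive_lipschitz_min (f : R[i] -> R) (a b : R) :
  0 < b ->
  (forall z w, f z <= f w + normc (z - w)) ->
  (forall z, normc z <= a + b * f z) ->
  exists z, forall w, f z <= f w.
Proof.
(* Beyond modulus [L], coercivity forces values above [f 0]. *)
move=> b0 Lf coer; pose L := Num.max 0 (a + b * f 0).
have L0 : 0 <= L by rewrite le_max lexx.
have LL : - L <= L by lra.
have h1 x : exists y, y \in `[- L, L] /\
    forall y', y' \in `[- L, L] -> f (x +i* y) <= f (x +i* y').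
  have [|y yL hy] := @EVT_min R (fun y => f (x +i* y)) _ _ LL.
    apply: lipschitz_continuous => y y'; apply: le_trans (Lf _ (x +i* y')) _.
    by rewrite lerD2l /normc /= subrr expr0n add0r sqrtr_sqr.
  by exists y.
have [Y hY] := choice h1.
have [|x xL hx] := @EVT_min R (fun x => f (x +i* Y x)) _ _ LL.
  apply: lipschitz_continuous => x x'.
  apply: le_trans ((hY x).2 _ (hY x').1) _; apply: le_trans (Lf _ (x' +i* Y x')) _.
  by rewrite lerD2l /normc /= subrr expr0n addr0 sqrtr_sqr.
exists (x +i* Y x) => -[u v].
have inL t : `|t| <= L -> t \in `[- L, L] by rewrite ler_norml in_itv.
have sq z : normc z <= L -> f (x +i* Y x) <= f z.
  case: z => p q zL.
  apply: le_trans (hx p (inL _ (le_trans (Re_le_normc (p +i* q)) zL))) _.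
  exact: (hY p).2 (inL _ (le_trans (Im_le_normc (p +i* q)) zL)).
have [|Lw] := leP (normc (u +i* v)) L; first exact: sq.
have f0 : f (x +i* Y x) <= f 0 by apply: sq; rewrite normc0.
apply: le_trans f0 _; rewrite -(ler_pM2l b0) -(lerD2l a).
apply: le_trans (coer _); apply: le_trans (ltW Lw).
by rewrite /L le_max lexx orbT.
Qed.

End ScalarModulus.

(** * Seminorms and the Gelfand-Mazur theorem *)

Lemma prim_root_exists (F : closedFieldType) (n : nat) :
  n%:R != 0 :> F -> exists z : F, n.-primitive_root z.
Proof.
move=> n0; have n_gt0 : (0 < n)%N by case: n n0; rewrite ?eqxx.
pose p : {poly F} := 'X^n - 1; have [r Dp] := closed_field_poly_normal p.
rewrite (monicP _) ?monicXnsubC // scale1r in Dp.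
have rn1 : all n.-unity_root r by apply/allP=> z; rewrite -root_prod_XsubC -Dp.
have sz_r : (n < (size r).+1)%N by rewrite -(size_prod_XsubC r id) -Dp size_XnsubC.
have [|z] := hasP (has_prim_root n_gt0 rn1 _ sz_r); last by exists z.
by rewrite -separable_prod_XsubC -Dp separable_Xn_sub_1.
Qed.

Lemma sum_prim_root_expr (F : fieldType) (n k : nat) (z : F) :
  n.-primitive_root z -> (0 < k < n)%N -> \sum_(j < n) (z ^+ k) ^+ j = 0.
Proof.
move=> pz /andP[k0 kn]; have zk1 : z ^+ k - 1 != 0.
  by rewrite subr_eq0 -(prim_order_dvd pz) gtnNdvd.
apply: (mulfI zk1); rewrite -subrX1 -exprM mulnC exprM (prim_expr_order pz).
by rewrite expr1n subrr mulr0.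
Qed.

(** Write [q = p * p]: the factor [n * p ^ n] is at most the geometric sum of [p], hence bounded,
    and the other factor [p ^ n] tends to 0. *)
Lemma exists_mul_expr_lt (R : realType) (q d M : R) :
  0 <= q -> q < 1 -> 0 < d -> 0 <= M ->
  exists2 n, (0 < n)%N & n%:R * M * q ^+ n < d.
Proof.
move=> q0 q1 d0 M0; pose p := Num.sqrt q.
have p0 : 0 <= p by apply: sqrtr_ge0.
have p1 : p < 1 by rewrite -sqrtr1 ltr_sqrt.
have np n : n%:R * p ^+ n <= (1 - p)^-1.
  rewrite -div1r ler_pdivlMr ?subr_gt0 //.
  apply: (@le_trans _ _ ((\sum_(k < n) p ^+ k) * (1 - p))).
    rewrite ler_wpM2r ?subr_ge0 ?(ltW p1) // -[n in n%:R]card_ord.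
    rewrite mulr_natl -sumr_const.
    by apply: ler_sum => k _; rewrite ler_wiXn2l ?(ltW p1) // ltnW.
  by rewrite mulrC -opprB mulNr -subrX1 opprB gerBl exprn_ge0.
have := @cvg_geometric R (M * (1 - p)^-1) p.
rewrite ger0_norm // => /(_ p1)/(@cvgrPdist_lt _ R^o)/(_ d d0) [m _ Hm].
exists m.+1 => //; have := Hm m.+1 (leqnSn _); rewrite /geometric /= sub0r normrN.
move/(le_lt_trans (ler_norm _)); apply: le_lt_trans.
have -> : q = p * p by rewrite -expr2 sqr_sqrtr.
have -> : m.+1%:R * M * (p * p) ^+ m.+1 = (m.+1%:R * p ^+ m.+1) * (M * p ^+ m.+1).
  by rewrite exprMn; ring.
have -> : M * (1 - p)^-1 * p ^+ m.+1 = (1 - p)^-1 * (M * p ^+ m.+1) by ring.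
by rewrite ler_wpM2r ?np // mulr_ge0 ?exprn_ge0.
Qed.

Section Seminorms.
Variables (R : realType) (B : comAlgType R[i]).

(** Definiteness is left out so that the distance to an ideal, which vanishes on that ideal, is an
    instance. *)
Record seminorm (N : B -> R) : Prop := Seminorm {
  snD : forall x y, N (x + y) <= N x + N y;
  snZ : forall c x, N (c *: x) = normc c * N x;
  snM : forall x y, N (x * y) <= N x * N y }.

Variables (N : B -> R) (HN : seminorm N).

Lemma sn0 : N 0 = 0.
Proof. by rewrite -(scale0r (0 : B)) (snZ HN) normc0 mul0r. Qed.

Lemma snN x : N (- x) = N x.
Proof. by rewrite -scaleN1r (snZ HN) normcN normc1 mul1r. Qed.

Lemma snBC x y : N (x - y) = N (y - x).
Proof. by rewrite -opprB snN. Qed.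

Lemma sn_ge0 x : 0 <= N x.
Proof. by have := snD HN x (- x); rewrite subrr sn0 snN; lra. Qed.

Lemma snB x y : N (x - y) <= N x + N y.
Proof. by rewrite -(snN y) (snD HN). Qed.

Lemma sn_dist x y z : N (x - z) <= N (x - y) + N (y - z).
Proof. by rewrite -(subrKA y) (snD HN). Qed.

Lemma sn_rev x y : N x - N y <= N (x - y).
Proof. by rewrite lerBlDr; have := snD HN (x - y) y; rewrite subrK. Qed.

Lemma sn_sum I (r : seq I) (P : pred I) (F : I -> B) :
  N (\sum_(i <- r | P i) F i) <= \sum_(i <- r | P i) N (F i).
Proof.
elim/big_rec2: _ => [|i y x _ IH]; first by rewrite sn0.
by apply: le_trans (snD HN _ _) _; rewrite lerD2l.
Qed.

Lemma snX x n : N (x ^+ n.+1) <= N x ^+ n.+1.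
Proof.
elim: n => [|n IH]; first by rewrite !expr1.
by rewrite exprS [N x ^+ _]exprS;
  apply: le_trans (snM HN _ _) _; rewrite ler_wpM2l ?sn_ge0.
Qed.

Lemma snMn x n : N (x *+ n) = n%:R * N x.
Proof.
by rewrite -scaler_nat (snZ HN) -(rmorph_nat (real_complex R)) normc_real ger0_norm.
Qed.

Lemma sn_kerD x y : N x = 0 -> N y = 0 -> N (x + y) = 0.
Proof.
move=> x0 y0; apply/eqP; rewrite eq_le sn_ge0 andbT.
by apply: le_trans (snD HN _ _) _; rewrite x0 y0 addr0.
Qed.

Lemma sn_kerM x y : N x = 0 -> N (x * y) = 0.
Proof.
move=> x0; apply/eqP; rewrite eq_le sn_ge0 andbT.
by apply: le_trans (snM HN _ _) _; rewrite x0 mul0r.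
Qed.

Lemma sn_ker_sum I (r : seq I) (F : I -> B) :
  (forall i, N (F i) = 0) -> N (\sum_(i <- r) F i) = 0.
Proof.
by move=> F0; elim/big_rec: _ => [|i x _ IH]; rewrite ?sn0 // sn_kerD.
Qed.

Lemma sn_eq x y : N (x - y) = 0 -> N x = N y.
Proof.
move=> xy; apply/eqP; rewrite eq_le -![_ <= N _]subr_le0 -{1}xy sn_rev.
by rewrite -xy snBC sn_rev.
Qed.

Lemma sn_le1 : 0 < N 1 -> 1 <= N 1.
Proof. by move=> N1; rewrite -(ler_pM2l N1) mulr1 -{1}(mulr1 (1 : B)) (snM HN). Qed.

End Seminorms.

(** * Resolvents modulo the kernel of a seminorm, and the non-emptiness of the spectrum *)

Section GelfandMazur.
Variables (R : realType) (B : comAlgType R[i]).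
Variables (N : B -> R) (HN : seminorm N) (N1 : 0 < N 1).
Variables (x : B) (r : R[i] -> B).
Hypothesis rK : forall l, N (r l * (x - l%:A) - 1) = 0.

Lemma resolvent_eq l m : N (r m - r l - (m - l) *: (r l * r m)) = 0.
Proof.
have -> : r m - r l - (m - l) *: (r l * r m) =
  (r m * (x - m%:A) - 1) * r l + (r l * (x - l%:A) - 1) * - r m.
  by rewrite scalerBl -[m *: (_ * _)]mulr_algl -[l *: (_ * _)]mulr_algl; ring.
by rewrite (sn_kerD HN) // (sn_kerM HN).
Qed.

Lemma resolvent_gt0 l : 0 < N (r l).
Proof.
rewrite lt_def (sn_ge0 HN) andbT; apply/eqP => r0.
have := sn_eq HN (rK l); rewrite (sn_kerM HN) // => /esym.
by apply/eqP; rewrite gt_eqF.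
Qed.

(** The resolvent identity divided by [N (r l) * N (r m)]. Passing to reciprocals turns the search
    for a maximum of the resolvent norm into a coercive minimum problem. *)
Lemma resolvent_lipschitz l m : (N (r l))^-1 <= (N (r m))^-1 + normc (l - m).
Proof.
have rl := resolvent_gt0 l; have rm := resolvent_gt0 m.
have : N (r m) <= N (r l) + normc (l - m) * (N (r l) * N (r m)).
  have /(sn_eq HN) E : N (r m - (r l + (m - l) *: (r l * r m))) = 0.
    by rewrite opprD addrA resolvent_eq.
  rewrite [leLHS]E; apply: le_trans (snD HN _ _) _.
  rewrite lerD2l (snZ HN) normc_sub.
  by rewrite ler_wpM2l ?normc_ge0 ?(snM HN).
rewrite -(ler_pM2l (_ : 0 < (N (r l))^-1 * (N (r m))^-1)); last first.
  by rewrite mulr_gt0 ?invr_gt0.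
set X := (X in X <= _); set Y := (X in _ <= X).
have -> : X = (N (r l))^-1 by rewrite /X; field; rewrite !gt_eqF.
suff -> : Y = (N (r m))^-1 + normc (l - m) by [].
by rewrite /Y; field; rewrite !gt_eqF.
Qed.

Lemma resolvent_coercive l : normc l <= N x + N 1 * (N (r l))^-1.
Proof.
have rl := resolvent_gt0 l.
have H : normc l * N (r l) <= N (r l) * N x + N 1.
  rewrite -(snZ HN); have /(sn_eq HN) -> : N (l *: r l - (r l * x - 1)) = 0.
    have -> : l *: r l - (r l * x - 1) = (r l * (x - l%:A) - 1) * (- 1).
      by rewrite -[l *: r l]mulr_algl; ring.
    exact: sn_kerM.
  by apply: le_trans (snB HN _ _) _; rewrite lerD2r (snM HN).
rewrite -(ler_pM2r rl) (le_trans H) // mulrDl mulrC lerD2l.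
by rewrite -mulrA mulVf ?mulr1 // gt_eqF.
Qed.

(* Discrete mean value property: for the n-th roots of unity w the average of
   r (l + t w) is r l / (1 - (t r l)^n), which tends to r l; since every term has
   norm at most N (r l), each of them must attain this maximum. *)
Lemma resolvent_max_ball l t :
  (forall m, N (r m) <= N (r l)) -> normc t * N (r l) < 1 ->
  N (r (l + t)) = N (r l).
Proof.
set M := N (r l) => maxM tM; apply/eqP; rewrite eq_le maxM /= leNgt.
apply/negP => lt_yM.
pose u := t *: r l; pose q := N u.
have qE : q = normc t * M by rewrite /q (snZ HN).
have q0 : 0 <= q := sn_ge0 HN u.
have q1 : q < 1 by rewrite qE.
have M0 : 0 <= M := sn_ge0 HN _.
have d0 : 0 < M - N (r (l + t)) by rewrite subr_gt0.
have [n n0 Hn] := exists_mul_expr_lt q0 q1 d0 M0.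
have [|w pw] := @prim_root_exists R[i] n; first by rewrite pnatr_eq0 -lt0n.
case: n n0 Hn pw => // n _ Hn pw.
pose y (j : nat) := r (l + t * w ^+ j).
pose v (j : nat) : B := w ^+ j *: u.
have ker_y j : N (y j * (1 - v j) - r l) = 0.
  have -> : y j * (1 - v j) - r l =
    (r l * (x - l%:A) - 1) * - y j + (y j * (x - (l + t * w ^+ j)%:A) - 1) * r l.
    rewrite /v /u scalerA [w ^+ j * t]mulrC scalerDl.
    by rewrite -[(t * _) *: r l]mulr_algl; ring.
  by apply: (sn_kerD HN); apply: (sn_kerM HN); apply: rK.
(* Modulo the kernel, [y j] is [r l / (1 - w^j u)]. Expanding into geometric sums and averaging over
   the roots of unity leaves only the exponent 0. *)
have ker_sum : N ((\sum_(j < n.+1) y j) * (1 - u ^+ n.+1) - r l *+ n.+1) = 0.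
  have -> : (\sum_(j < n.+1) y j) * (1 - u ^+ n.+1) - r l *+ n.+1 =
     \sum_(j < n.+1) ((y j * (1 - v j) - r l) * \sum_(k < n.+1) v j ^+ k).
    have -> : r l *+ n.+1 = \sum_(j < n.+1) r l * \sum_(k < n.+1) v j ^+ k.
      rewrite -mulr_sumr exchange_big /= big_ord_recl.
      rewrite (eq_bigr (fun=> 1)) => [|j _]; last by rewrite expr0.
      rewrite sumr_const card_ord big1 ?addr0 ?mulr_natr // => k _.
      rewrite (eq_bigr (fun j : 'I_n.+1 => (w ^+ k.+1) ^+ j *: u ^+ k.+1));
        last first.
        by move=> j _; rewrite exprZn -!exprM mulnC.
      rewrite -scaler_suml (sum_prim_root_expr pw) ?scale0r //; exact: ltn_ord.
    rewrite mulr_suml -sumrB; apply: eq_bigr => j _.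
    have -> : u ^+ n.+1 = v j ^+ n.+1.
      by rewrite [RHS]exprZn -exprM mulnC exprM (prim_expr_order pw) expr1n scale1r.
    by rewrite mulrBl -[1 - v j ^+ _]opprB subrX1; ring.
  by apply: sn_ker_sum => // j; rewrite (sn_kerM HN).
(* The term [j = 0] is [r (l + t)]; the other [n] terms are bounded by [M]. By [Hn] the factor
   [1 + q ^+ n.+1] cannot make up for the gap [M - N (r (l + t))]. *)
have up : n.+1%:R * M <= (N (r (l + t)) + n%:R * M) * (1 + q ^+ n.+1).
  rewrite -(snMn HN); have/(sn_eq HN) <- := ker_sum; rewrite mulrBr mulr1.
  apply: le_trans (snB HN _ _) _.
  set Y := \sum_(j < n.+1) _.
  have NY : N Y <= N (r (l + t)) + n%:R * M.
    apply: le_trans (sn_sum HN _ _ _) _; rewrite big_ord_recl /y expr0 mulr1 lerD2l.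
    apply: (@le_trans _ _ (\sum_(i < n) M)); first exact: ler_sum.
    by rewrite sumr_const card_ord mulr_natl.
  rewrite mulrDr mulr1; apply: lerD => //; apply: le_trans (snM HN _ _) _.
  by apply: ler_pM => //; rewrite ?(sn_ge0 HN) ?(snX HN).
have qn : 0 <= q ^+ n.+1 by rewrite exprn_ge0.
have : (M - N (r (l + t))) * q ^+ n.+1 >= 0 by rewrite mulr_ge0 // ltW.
by move: up Hn; rewrite -!natr1; nra.
Qed.

(** From a maximum point of the resolvent norm, the maximum propagates in real steps of length
    [1 / (2 M)] arbitrarily far, whereas coercivity confines all maximum points to a disc. *)
Theorem gelfand_mazur : False.
Proof.
have [l lmin] := coercive_lipschitz_min N1 resolvent_lipschitz resolvent_coercive.
have maxl m : N (r m) <= N (r l).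
  by rewrite -lef_pV2 ?posrE ?resolvent_gt0.
set M := N (r l) in maxl; have M0 : 0 < M := resolvent_gt0 l.
pose s := (2 * M)^-1; have s0 : 0 < s by rewrite invr_gt0 mulr_gt0.
have const n : N (r (l + (s *+ n)%:C)) = M.
  elim: n => [|n IH]; first by rewrite mulr0n addr0.
  rewrite mulrSr rmorphD addrA -[RHS]IH; apply: resolvent_max_ball.
    by rewrite IH.
  rewrite IH normc_real gtr0_norm // /s invfM -mulrA mulVf ?gt_eqF //; lra.
pose b := N x + N 1 * M^-1.
have sb n : s *+ n <= b + normc l.
  have := resolvent_coercive (l + (s *+ n)%:C); rewrite const -/b => H.
  have -> : s *+ n = normc ((l + (s *+ n)%:C) - l).
    by rewrite addrAC subrr add0r normc_real ger0_norm // mulrn_wge0 // ltW.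
  by apply: le_trans (le_normcD _ _) _; rewrite normcN lerD2r.
have := archi_boundP (normr_ge0 ((b + normc l) / s)).
set n := Num.bound _; rewrite ltNge => /negP; apply.
apply: le_trans (ler_norm _); rewrite ler_pdivlMr // mulr_natl; exact: sb.
Qed.

End GelfandMazur.

(** * Complete algebra norms *)

Section BanachNorm.
Variables (R : realType) (B : comAlgType R[i]).

(** Completeness is phrased by series dominated by powers of 1/2 with an explicit remainder, so that
    later constructions work with estimates instead of limits. *)
Record banach_norm (N : B -> R) : Prop := BanachNorm {
  bn_seminorm :> seminorm N;
  bn_eq0 : forall x, N x = 0 -> x = 0;
  bn_complete : forall u : nat -> B, (forall n, N (u n) <= 2^-1 ^+ n) ->
    exists l, forall n, N (l - \sum_(i < n) u i) <= 2 * 2^-1 ^+ n }.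

Definition invertible (x : B) := exists y, y * x = 1.

Lemma invertibleM x y : invertible x -> invertible y -> invertible (x * y).
Proof.
by move=> [x' xK] [y' yK]; exists (x' * y'); rewrite mulrACA xK yK mulr1.
Qed.

Lemma invertible_mull x y : invertible (x * y) -> invertible x.
Proof. by move=> [z zK]; exists (z * y); rewrite -zK; ring. Qed.

Lemma invertibleZ c : c != 0 -> invertible c%:A.
Proof.
by move=> c0; exists c^-1%:A; rewrite -scalerAl mul1r scalerA mulVf ?scale1r.
Qed.

Lemma half_gt0 n : 0 < 2^-1 ^+ n :> R.
Proof. by rewrite exprn_gt0 // invr_gt0. Qed.

Lemma exists_half_lt (C d : R) : 0 <= C -> 0 < d -> exists n, C * 2^-1 ^+ n < d.
Proof.
move=> C0 d0; have [||n n0 H] := @exists_mul_expr_lt R 2^-1 d C _ _ d0 C0; [lra..|].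
exists n; apply: le_lt_trans H; rewrite -mulrA ler_peMl ?ler1n //.
by rewrite mulr_ge0 // ltW ?half_gt0.
Qed.

Lemma le0_of_half (a C : R) : (forall n, a <= C * 2^-1 ^+ n) -> a <= 0.
Proof.
move=> H; rewrite leNgt; apply/negP => a0.
have C0 : 0 <= C by have := H 0%N; rewrite expr0; lra.
by have [n] := exists_half_lt C0 a0; rewrite ltNge H.
Qed.

Variables (N : B -> R) (HB : banach_norm N).
Let HN : seminorm N := bn_seminorm HB.

Lemma bn_half0 C x : (forall n, N x <= C * 2^-1 ^+ n) -> x = 0.
Proof.
move=> H; apply: (bn_eq0 HB); apply/eqP; rewrite eq_le (sn_ge0 HN) andbT.
exact: le0_of_half H.
Qed.

Lemma snZr (a : R) x : 0 <= a -> N (a%:C *: x) = a * N x.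
Proof. by move=> a0; rewrite (snZ HN) normc_real ger0_norm. Qed.

Lemma neumann y : N y <= 2^-1 -> invertible (1 - y).
Proof.
move=> y2; have yn n : N (y ^+ n.+1) <= 2^-1 ^+ n.
  apply: le_trans (snX HN _ _) _; apply: (@le_trans _ _ (2^-1 ^+ n.+1)).
    by rewrite lerXn2r ?nnegrE ?(sn_ge0 HN) // invr_ge0.
  by rewrite exprS ler_piMl ?(ltW (half_gt0 _)) //; lra.
have [l Hl] := bn_complete HB yn; exists (1 + l); apply/eqP; rewrite -subr_eq0.
apply/eqP/(@bn_half0 (2 * N (1 - y) + 1)) => n.
have -> : (1 + l) * (1 - y) - 1 =
    (l - \sum_(i < n) y ^+ i.+1) * (1 - y) + - y ^+ n.+1.
  have -> : \sum_(i < n) y ^+ i.+1 = y * \sum_(i < n) y ^+ i.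
    by rewrite mulr_sumr; apply: eq_bigr => i _; rewrite exprS.
  have := subrX1 y n; rewrite exprS; set S := \sum_(i < n) _ => E.
  have -> : y ^+ n = (y - 1) * S + 1 by rewrite -E subrK.
  ring.
apply: le_trans (snD HN _ _) _; rewrite [leRHS]mulrDl mul1r (snN HN) lerD //.
apply: le_trans (snM HN _ _) _; rewrite mulrAC.
by rewrite ler_wpM2r ?(sn_ge0 HN).
Qed.

(** The element [1 - y] divides [1 - y ^+ n]. *)
Lemma neumannX y n : N (y ^+ n) <= 2^-1 -> invertible (1 - y).
Proof.
move/neumann; rewrite -opprB subrX1 -mulNr opprB; exact: invertible_mull.
Qed.

(** The quotient seminorm of [B / cB], pulled back to [B]; no quotient algebra has to be built. *)
Definition dist (c y : B) : R := inf [set N (y - c * z) | z in [set: B]]%classic.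

Lemma dist_le c y z : dist c y <= N (y - c * z).
Proof.
apply: ge_inf; last by exists z.
by exists 0 => _ [w _ <-]; exact: sn_ge0.
Qed.

Lemma distP c y e : 0 < e -> exists z, N (y - c * z) < dist c y + e.
Proof.
move=> e0; have [|_ [z _ <-] H] :=
  @inf_adherent R [set N (y - c * z) | z in [set: B]]%classic _ e0.
  split; first by exists (N (y - c * 0)), 0.
  by exists 0 => _ [w _ <-]; exact: sn_ge0.
by exists z.
Qed.

Lemma dist_ge0 c y : 0 <= dist c y.
Proof.
apply: lb_le_inf; first by exists (N (y - c * 0)), 0.
by move=> _ [w _ <-]; exact: sn_ge0.
Qed.

Lemma dist_le_norm c y : dist c y <= N y.
Proof. by have := dist_le c y 0; rewrite mulr0 subr0. Qed.

Lemma dist_ideal c y : dist c (c * y) = 0.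
Proof.
apply/eqP; rewrite eq_le dist_ge0 andbT.
by have := dist_le c (c * y) y; rewrite subrr (sn0 HN).
Qed.

Lemma dist_seminorm c : seminorm (dist c).
Proof.
have leZ k x : dist c (k *: x) <= normc k * dist c x.
  apply/ler_addgt0Pr => e e0; have n0 := normc_ge0 k.
  have e1 : 0 < e / (normc k + 1) by rewrite divr_gt0 //; lra.
  have [z Hz] := distP c x e1.
  apply: le_trans (dist_le c _ (k *: z)) _.
  rewrite -scalerAr -scalerBr (snZ HN).
  apply: (le_trans (ler_wpM2l n0 (ltW Hz))); rewrite mulrDr lerD2l.
  by rewrite mulrCA ler_piMr ?(ltW e0) // ler_pdivrMr; lra.
split.
- move=> x y; apply/ler_addgt0Pr => e e0.
  have e2 : 0 < e / 2 by lra.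
  have [z Hz] := distP c x e2; have [w Hw] := distP c y e2.
  apply: le_trans (dist_le c _ (z + w)) _.
  have -> : x + y - c * (z + w) = (x - c * z) + (y - c * w) by ring.
  by apply: le_trans (snD HN _ _) _; lra.
- move=> k x; apply/eqP; rewrite eq_le leZ /=.
  have [->|k0] := eqVneq k 0; first by rewrite normc0 mul0r dist_ge0.
  have := leZ k^-1 (k *: x); rewrite scalerA mulVf // scale1r normcV.
  rewrite -ler_pdivlMl // lt_def normc_ge0 andbT; apply: contra_neq k0.
  exact: eq0_normc.
- move=> x y; apply/ler_addgt0Pr => e e0.
  pose K := dist c x + dist c y + 1.
  have dx := dist_ge0 c x; have dy := dist_ge0 c y.
  pose t := Num.min 1 (e / K).
  have K0 : 0 < K by rewrite /K; lra.
  have t0 : 0 < t by rewrite lt_min ltr01 divr_gt0.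
  have t1 : t <= 1 by rewrite ge_min lexx.
  have tK : t * K <= e by rewrite -ler_pdivlMr // ge_min lexx orbT.
  have [z Hz] := distP c x t0; have [w Hw] := distP c y t0.
  apply: le_trans (dist_le c _ (z * y + x * w - c * z * w)) _.
  have -> : x * y - c * (z * y + x * w - c * z * w) =
    (x - c * z) * (y - c * w) by ring.
  apply: le_trans (snM HN _ _) _.
  apply: (le_trans (ler_pM _ _ (ltW Hz) (ltW Hw))); rewrite ?(sn_ge0 HN) //.
  by move: tK; rewrite /K; nra.
Qed.

(** A multiple of [c] closer to 1 than 1/2 would be invertible by the Neumann series. *)
Lemma dist1_ge c : ~ invertible c -> 2^-1 <= dist c 1.
Proof.
move=> nc; rewrite leNgt; apply/negP => d1.
have e0 : 0 < 2^-1 - dist c 1 by rewrite subr_gt0.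
have [z] := distP c 1 e0; rewrite subrKC => /ltW/neumann.
by rewrite subKr => /invertible_mull.
Qed.

(* If 1 - b x is not invertible then x is invertible modulo 1 - b x with inverse
   b, so that its spectrum in the quotient is empty. *)
Lemma spectrum0_radical x :
  (forall l, l != 0 -> invertible (x - l%:A)) -> forall b, invertible (1 - b * x).
Proof.
move=> Hx b; apply: contrapT => nc; set c := 1 - b * x in nc.
have HC := dist_seminorm c.
have /choice [r rK] : forall l : R[i], exists y, dist c (y * (x - l%:A) - 1) = 0.
  move=> l; have [->|/Hx [y yE]] := eqVneq l 0; last first.
    by exists y; rewrite yE subrr (sn0 HC).
  exists b; rewrite scale0r subr0.
  have -> : b * x - 1 = c * - 1 by rewrite /c; ring.
  exact: dist_ideal.
apply: (gelfand_mazur HC _ rK).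
by apply: lt_le_trans (dist1_ge nc); rewrite invr_gt0.
Qed.

End BanachNorm.

(** * The closed graph theorem *)

Section ClosedGraph.
Variables (R : realType) (B : comAlgType R[i]) (N : B -> R).
Hypothesis HB : banach_norm N.
Let HN : seminorm N := bn_seminorm HB.
Variable D : {linear B -> B}.

(** Membership in the separating space: [y] is a limit of values [D x] with [x] tending to 0. The
    graph of [D] is closed exactly when only 0 qualifies. *)
Definition separating (y : B) :=
  forall e, 0 < e -> exists x, N x < e /\ N (D x - y) < e.

(** Baire's argument: if no set [N (D y) <= m] were dense in a ball, nested balls could leave these
    sets one after another, and [N (D l)] would exceed every integer at their common point [l]. *)
Lemma baire_ball : exists (c : B) (r m : R), 0 < r /\
  forall x, N (x - c) <= r -> forall e, 0 < e ->
    exists y, N (x - y) < e /\ N (D y) <= m.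
Proof.
apply: contrapT => H.
have /choice [G GP] : forall p : B * R * nat, exists q : B * R, 0 < p.1.2 ->
    [/\ N (q.1 - p.1.1) <= p.1.2, 0 < q.2 &
        forall y, N (q.1 - y) < q.2 -> p.2%:R < N (D y)].
  move=> [[c r] m] /=; have [r0|nr] := pselect (0 < r); last by exists (c, r) => /nr.
  apply: contrapT => H1; apply: H; exists c, r, m%:R; split=> // x xc e e0.
  apply: contrapT => H2; apply: H1; exists (x, e) => _; split=> // y xy.
  by rewrite ltNge; apply/negP => Dy; apply: H2; exists y.
(* The new radius is at most half the escape radius and half the old radius: the balls nest and the
   centres converge geometrically. *)
pose st n := iteri n (fun i p =>
  let q := G (p.1, p.2 / 2, i) in (q.1, Num.min q.2 p.2 / 2)) (0 : B, 1 : R).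
pose c n := (st n).1; pose r n := (st n).2.
have r0 n : 0 < r n.
  elim: n => [|n IH]; first exact: ltr01.
  rewrite /r /= divr_gt0 // lt_min -/(r n) IH andbT.
  have [|_ + _] := GP (c n, r n / 2, n); [by rewrite /= divr_gt0|exact].
have step n : [/\ N (c n.+1 - c n) <= r n / 2, r n.+1 <= r n / 2 &
    forall y, N (c n.+1 - y) <= r n.+1 -> n%:R < N (D y)].
  have [|H1 H2 H3] := GP (c n, r n / 2, n); first by rewrite /= divr_gt0.
  split=> [||y yc]; first exact: H1.
    by rewrite /r /= ler_pM2r // ge_min lexx orbT.
  apply: H3; apply: (le_lt_trans yc); rewrite /r /= -/(c n) -/(r n).
  have /= := r0 n.+1; rewrite /r /= -/(c n) -/(r n) => rn.
  have : Num.min (G (c n, r n / 2, n)).2 (r n) <= (G (c n, r n / 2, n)).2.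
    by rewrite ge_min lexx.
  lra.
have rh n : r n <= 2^-1 ^+ n.
  elim: n => [|n IH]; first by [].
  by have [_ + _] := step n; rewrite exprS; lra.
have uh n : N (c n.+1 - c n) <= 2^-1 ^+ n.
  by have [+ _ _] := step n; have := rh n; have := r0 n; lra.
have [l Hl] := bn_complete HB uh.
have lc n : N (l - c n) <= 2 * 2^-1 ^+ n.
  by have := Hl n; rewrite -(big_mkord xpredT (fun i => c i.+1 - c i))
    telescope_sumr // /c /= subr0.
have nest n k : N (c (k + n)%N - c n) + r (k + n)%N <= r n.
  elim: k => [|k IH]; first by rewrite subrr (sn0 HN) add0r.
  have [H1 H2 _] := step (k + n)%N; rewrite addSn.
  by have := sn_dist HN (c (k + n).+1) (c (k + n)%N) (c n); lra.
have lr n : N (c n - l) <= r n.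
  rewrite -subr_le0; apply: (@le0_of_half _ _ 2) => k.
  have := sn_dist HN (c n) (c (k + n)%N) l.
  rewrite [X in _ <= X + _](snBC HN) [X in _ <= _ + X](snBC HN).
  have := nest n k; have := lc (k + n)%N; have := r0 (k + n)%N.
  have : 2^-1 ^+ (k + n) <= 2^-1 ^+ k :> R.
    by rewrite ler_wiXn2l ?leq_addr //; lra.
  lra.
have := archi_boundP (sn_ge0 HN (D l)); set n := Num.bound _.
have [_ _ /(_ l (lr _))] := step n; lra.
Qed.

Theorem closed_graph : (forall y, separating y -> y = 0) ->
  exists2 C, 0 <= C & forall x, N (D x) <= C * N x.
Proof.
move=> closedD; have [c [r [m [r0 Hcr]]]] := baire_ball.
have m0 : 0 <= m.
  have [|y [_ /(le_trans (sn_ge0 HN _))]] := Hcr c _ 1 ltr01; last by [];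
  by rewrite subrr (sn0 HN) ltW.
pose M := 2 * m + 1; have M0 : 0 < M by rewrite /M; lra.
(* Subtracting an approximation of [c] moves the ball to the origin at the cost of doubling [m]; the
   extra 1 in [M] makes it positive. *)
have approx0 x e : N x <= r -> 0 < e -> exists y, N (x - y) < e /\ N (D y) <= M.
  move=> xr e0; have e2 : 0 < e / 2 by lra.
  have [|y [y1 y2]] := Hcr (x + c) _ _ e2; first by rewrite addrK.
  have [|z [z1 z2]] := Hcr c _ _ e2; first by rewrite subrr (sn0 HN) ltW.
  exists (y - z); split.
    have -> : x - (y - z) = (x + c - y) - (c - z) by ring.
    by apply: le_lt_trans (snB HN _ _) _; lra.
  by rewrite linearB; apply: le_trans (snB HN _ _) _; rewrite /M; lra.
have /choice [Y HY] : forall p : nat * B, exists y, N p.2 <= r * 2^-1 ^+ p.1 ->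
    N (p.2 - y) <= r * 2^-1 ^+ p.1.+1 /\ N (D y) <= M * 2^-1 ^+ p.1.
  move=> [n x] /=; have h0 := half_gt0 R n; set h := 2^-1 ^+ n in h0 *.
  have [xr|nxr] := pselect (N x <= r * h); last by exists 0 => /nxr.
  have hi0 : 0 <= h^-1 by rewrite invr_ge0 ltW.
  have [||y [y1 y2]] := approx0 (h^-1%:C *: x) (r / 2); [|lra|].
    by rewrite (snZr HB) // mulrC ler_pdivrMr.
  exists (h%:C *: y) => _; split.
    have -> : x = h%:C *: (h^-1%:C *: x).
      by rewrite scalerA -rmorphM mulfV ?gt_eqF // scale1r.
    rewrite -scalerBr (snZr HB) ?(ltW h0) // exprS -/h.
    by have := ler_wpM2l (ltW h0) (ltW y1); lra.
  by rewrite linearZ /= (snZr HB) ?(ltW h0) // mulrC ler_wpM2r // ltW.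
have small x : N x <= r -> N (D x) <= M * 2.
  (* Successive approximation: [z n] is what remains of [x] after [n] corrections. The images of the
     corrections sum to [M%:C *: l], and closedness of the graph identifies this sum with [D x]. *)
  move=> xr; pose z n := iteri n (fun i w => w - Y (i, w)) x.
  have zr n : N (z n) <= r * 2^-1 ^+ n.
    by elim: n => [|n IH]; [rewrite expr0 mulr1 | have [] := HY (n, z n) IH].
  pose u n := M^-1%:C *: D (Y (n, z n)).
  have uh n : N (u n) <= 2^-1 ^+ n.
    have [_ H] := HY (n, z n) (zr n).
    by rewrite /u (snZr HB) ?invr_ge0 ?(ltW M0) // mulrC ler_pdivrMr // mulrC.
  have [l Hl] := bn_complete HB uh.
  have sumu n : \sum_(i < n) u i = M^-1%:C *: (D x - D (z n)).
    elim: n => [|n IH]; first by rewrite big_ord0 subrr scaler0.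
    rewrite big_ord_recr IH /u /= -scalerDr /= [D (z n - _)]linearB opprB.
    by congr (_ *: _); ring.
  have Dl : D x - M%:C *: l = 0.
    apply: closedD => e e0.
    have K0 : 0 <= r + M * 2 by lra.
    have [n Hn] := exists_half_lt K0 e0; exists (z n).
    have h0 := half_gt0 R n; split.
      by apply: le_lt_trans (zr n) _; apply: le_lt_trans Hn; nra.
    have -> : D (z n) - (D x - M%:C *: l) = M%:C *: (l - \sum_(i < n) u i).
      rewrite sumu scalerBr scalerA -rmorphM mulfV ?gt_eqF // scale1r.
      by ring.
    rewrite (snZr HB) ?(ltW M0) //; apply: le_lt_trans Hn.
    by have := ler_wpM2l (ltW M0) (Hl n); nra.
  move/eqP: Dl; rewrite subr_eq0 => /eqP ->; rewrite (snZr HB) ?(ltW M0) //.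
  rewrite ler_pM2l //.
  by have := Hl 0%N; rewrite big_ord0 subr0 expr0 mulr1.
exists (M * 2 / r) => [|x]; first by rewrite divr_ge0 ?(ltW r0) //; lra.
have [Nx0|Nx0] := eqVneq (N x) 0.
  by rewrite (bn_eq0 HB Nx0) linear0 (sn0 HN) mulr0.
have x0 : 0 < N x by rewrite lt_def Nx0 (sn_ge0 HN).
have t0 : 0 <= r / N x by rewrite divr_ge0 ?ltW.
have := small ((r / N x)%:C *: x); rewrite linearZ /= !(snZr HB) // divfK //.
move=> /(_ (lexx _)) H.
rewrite -(ler_pM2l (divr_gt0 r0 x0)) (le_trans H) //.
by rewrite le_eqVlt; apply/orP; left; apply/eqP; field; rewrite !gt_eqF.
Qed.

End ClosedGraph.

(** * Derivations of semisimple commutative Banach algebras *)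

Section Derivations.
Variables (R : realType) (B : comAlgType R[i]) (N : B -> R).
Hypothesis HB : banach_norm N.
Let HN : seminorm N := bn_seminorm HB.
Variable D : {linear B -> B}.
Hypothesis DM : forall x y, D (x * y) = D x * y + x * D y.

Lemma bn1_gt0 : 0 < N 1.
Proof.
rewrite lt_def (sn_ge0 HN) andbT; apply/eqP => /(bn_eq0 HB)/eqP.
by rewrite oner_eq0.
Qed.

(** * The Kleinecke-Shirokov identity and bounded derivations *)

Section KleineckeShirokov.
Variable a : B.

(** The commutator of [T] with multiplication by [a]; for [T = D] it is multiplication by [D a]. *)
Definition comm_op (T : B -> B) (x : B) : B := T (a * x) - a * T x.

(** Leibniz rule for iterated commutators of a composite: the second commutator of [D] vanishes by
    commutativity, so two terms survive. At [m = 0] the coefficient hides the truncated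
    predecessor. *)
Lemma iter_comm_op_comp (T : B -> B) m x :
  iter m comm_op (D \o T) x =
  D (iter m comm_op T x) + m%:R * (D a * iter m.-1 comm_op T x).
Proof.
elim: m x => [|m IH] x; first by rewrite mul0r addr0.
rewrite !iterS [LHS]/comm_op !IH [comm_op _ _ in RHS]/comm_op linearB DM.
case: m {IH} => [|m]; first by rewrite /= !mul0r mul1r; ring.
rewrite -[m.+2%:R]natr1 /= [comm_op (iter m _ _) x in RHS]/comm_op.
by rewrite [comm_op (iter m _ _) (a * x)]/comm_op
  [comm_op (iter m _ _) x]/comm_op; ring.
Qed.

(** The power [D^n] behaves like a differential operator of order [n]: each commutator lowers the
    order by one. *)
Lemma iter_comm_op_gt n m x : (n < m)%N -> iter m comm_op (iter n D) x = 0.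
Proof.
elim: n m x => [|n IH] m x.
  elim: m x => // -[_ x _|m IHm x _]; first by rewrite /= /comm_op subrr.
  by rewrite iterS /comm_op !IHm // mulr0 subrr.
case: m => // m nm; have /funext -> : iter n.+1 D =1 D \o iter n D by [].
rewrite iter_comm_op_comp !IH ?linear0 ?mulr0 ?addr0 //.
exact: ltnW nm.
Qed.

Lemma iter_comm_op_eq n x :
  iter n comm_op (iter n D) x = (D a ^+ n * x) *+ n`!.
Proof.
elim: n x => [|n IH] x; first by rewrite /= mul1r.
have -> : iter n.+1 D = D \o iter n D by [].
rewrite iter_comm_op_comp iter_comm_op_gt // linear0 add0r IH.
by rewrite mulrnAr mulrA -exprS mulr_natl -mulrnA mulnC -factS.
Qed.

Lemma iter_comm_op_bound (T : B -> B) C m x : 0 <= C ->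
  (forall x, N (T x) <= C * N x) ->
  N (iter m comm_op T x) <= (2 * N a) ^+ m * C * N x.
Proof.
move=> C0 TC; elim: m x => [|m IH] x; first by rewrite mul1r.
rewrite iterS /comm_op; apply: le_trans (snB HN _ _) _.
have a0 := sn_ge0 HN a.
have H1 := IH (a * x); have H2 := ler_wpM2l a0 (IH x).
have H3 := snM HN a (iter m comm_op T x); have := snM HN a x.
have K0 : 0 <= (2 * N a) ^+ m * C by rewrite mulr_ge0 ?exprn_ge0 // mulr_ge0.
move=> /(ler_wpM2l K0) H4; rewrite exprS.
apply: (@le_trans _ _ ((2 * N a) ^+ m * C * (N a * N x) +
    N a * ((2 * N a) ^+ m * C * N x))).
  by apply: lerD; [exact: le_trans H1 H4|exact: le_trans H3 H2].
by rewrite le_eqVlt; apply/orP; left; apply/eqP; ring.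
Qed.

End KleineckeShirokov.

Lemma exists_expr_fact_lt (C d : R) : 0 < d -> exists n, C ^+ n / n`!%:R < d.
Proof.
move=> d0; have := cvg_exp_coeff C.
move=> /(@cvgrPdist_lt _ R^o)/(_ d d0) [n _ Hn]; exists n.
by have := Hn n (leqnn n); rewrite sub0r normrN => /(le_lt_trans (ler_norm _)).
Qed.

Lemma bounded_derivation_radical K : 0 <= K ->
  (forall x, N (D x) <= K * N x) -> forall a b, invertible (1 - b * D a).
Proof.
move=> K0 DK a b.
have DnK n x : N (iter n D x) <= K ^+ n * N x.
  elim: n => [|n IH]; first by rewrite mul1r.
  by rewrite iterS (le_trans (DK _)) // exprS -mulrA ler_wpM2l.
have a0 := sn_ge0 HN a; have N1 := bn1_gt0.
have bn n : N (D a ^+ n) <= (2 * N a * K) ^+ n * N 1 / n`!%:R.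
  rewrite ler_pdivlMr ?ltr0n ?fact_gt0 // mulrC -[_`!%:R * _](snMn HN).
  rewrite -[D a ^+ n]mulr1 -iter_comm_op_eq [(2 * _ * K) ^+ n]exprMn.
  by apply: iter_comm_op_bound; rewrite ?exprn_ge0.
have bX n : N (b ^+ n) <= N 1 * N b ^+ n.
  elim: n => [|n IH]; first by rewrite mulr1.
  rewrite exprSr [N b ^+ _]exprSr mulrA (le_trans (snM HN _ _)) //.
  by rewrite ler_wpM2r ?(sn_ge0 HN).
(* One factor [N 1] comes from the bound on [b ^+ n], the other from the bound on [D a ^+ n]. *)
have d0 : 0 < 2^-1 / (N 1 * N 1) by rewrite divr_gt0 ?invr_gt0 // mulr_gt0.
have [n Hn] := exists_expr_fact_lt (N b * (2 * N a * K)) d0.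
apply: (neumannX HB (n := n)); rewrite exprMn.
apply: le_trans (snM HN _ _) _.
apply: le_trans (ler_pM (sn_ge0 HN _) (sn_ge0 HN _) (bX n) (bn n)) _.
move: Hn; rewrite ltr_pdivlMr ?mulr_gt0 // [(N b * _) ^+ n]exprMn => /ltW.
by apply: le_trans; rewrite le_eqVlt; apply/orP; left; apply/eqP; ring.
Qed.

(** * The gliding hump for a separating element with infinite spectrum *)

Section GlidingHump.
Variables (s : B) (lam : nat -> R[i]).
Hypotheses (sep_s : separating N D s) (lam_inj : injective lam).
Hypotheses (lam_neq0 : forall n, lam n != 0).
Hypothesis lam_sp : forall n, ~ invertible (s - (lam n)%:A).

Let c n := s - (lam n)%:A.
Let P n := \prod_(i < n) c i.
Let d n := dist N (c n).
Let dS n : seminorm (d n) := dist_seminorm HB (c n).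

(** Modulo [c n] the element [s] acts as the scalar [lam n]. *)
Lemma hump_dist_mul n mu y : d n ((s - mu%:A) * y) = normc (lam n - mu) * d n y.
Proof.
rewrite -(snZ (dS n)); apply: (sn_eq (dS n)).
have -> : (s - mu%:A) * y - (lam n - mu) *: y = c n * y.
  by rewrite -[(lam n - mu) *: y]mulr_algl scalerBl /c; ring.
exact: dist_ideal.
Qed.

Lemma hump_dist_prod n m y :
  d n (P m * y) = \prod_(i < m) normc (lam n - lam i) * d n y.
Proof.
elim: m y => [|m IH] y; first by rewrite /P !big_ord0 !mul1r.
by rewrite /P !big_ord_recr /= -!mulrA IH hump_dist_mul.
Qed.

Let gamma n := d n (P n * s).

Lemma hump_gamma_gt0 n : 0 < gamma n.
Proof.
rewrite /gamma hump_dist_prod -[s in d n s]mulr1 -[s in s * 1]subr0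
  -(scale0r (1 : B)).
rewrite hump_dist_mul subr0 !mulr_gt0 //.
- apply: prodr_gt0 => i _; rewrite lt_def normc_ge0 andbT.
  apply: contra_neq (_ : lam n - lam i != 0); first exact: eq0_normc.
  by rewrite subr_eq0 (inj_eq lam_inj) gtn_eqF.
- rewrite lt_def normc_ge0 andbT.
  by apply: contra_neq (lam_neq0 n); exact: eq0_normc.
- by apply: lt_le_trans (dist1_ge HB (@lam_sp n)); rewrite invr_gt0.
Qed.

(** Values [D x] with [x] tiny come close to [s], so [P n * D x] stays at distance at least
    [gamma n / 2] from the ideal; scaling by [t] raises this to [K]. *)
Lemma hump_big n K e : 0 <= K -> 0 < e ->
  exists x, N x <= e /\ K <= d n (P n * D x).
Proof.
move=> K0 e0; have g0 := hump_gamma_gt0 n; have p0 := sn_ge0 HN (P n).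
pose t := 2 * K / gamma n.
have t0 : 0 <= t by rewrite divr_ge0 ?mulr_ge0 // ltW.
(* The first bound keeps [t x] within [e]; the second lets replacing [s] by [D x] cost at most half
   of [gamma n]. *)
pose e' := Num.min (e / (t + 1)) (gamma n / (2 * (N (P n) + 1))).
have e'0 : 0 < e' by rewrite lt_min !divr_gt0 ?mulr_gt0 //; lra.
have e'1 : e' * (t + 1) <= e by rewrite -ler_pdivlMr ?ge_min ?lexx //; lra.
have e'2 : e' * (2 * (N (P n) + 1)) <= gamma n.
  by rewrite -ler_pdivlMr ?ge_min ?lexx ?orbT //; lra.
have [x [x1 x2]] := sep_s e'0; exists (t%:C *: x).
rewrite (snZr HB) //; split.
  by apply: le_trans (_ : t * e' <= _); [rewrite ler_wpM2l // ltW|lra].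
rewrite linearZ /= -scalerAr (snZ (dS n)) normc_real ger0_norm //.
have : gamma n / 2 <= d n (P n * D x).
  have := sn_dist (dS n) (P n * s) (P n * D x) 0.
  have -> : P n * s - P n * D x = - (P n * (D x - s)) by ring.
  rewrite !subr0 (snN (dS n)) -/(gamma n) => H.
  have := dist_le_norm HB (c n) (P n * (D x - s)); rewrite -/(d n _).
  move/le_trans => /(_ _ (snM HN _ _)).
  have := ler_wpM2l p0 (ltW x2); lra.
move/(ler_wpM2l t0); apply: le_trans.
by rewrite le_eqVlt; apply/orP; left; apply/eqP; rewrite /t; field; rewrite gt_eqF.
Qed.

(** A common bound for all products [Q n j] with [n + j = m], so that a single smallness condition
    on the [m]-th hump serves every tail series. *)
Let W m := N 1 * \prod_(i < m) (1 + N (c i)).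
Let Q n j := \prod_(i < j) c (n + i).

Lemma hump_W_ge1 m : 1 <= W m.
Proof.
apply: (@le_trans _ _ (1 * 1)); first by rewrite mulr1.
apply: ler_pM => //; first exact: (sn_le1 HN bn1_gt0).
elim/big_rec: _ => // i x _; have := sn_ge0 HN (c i); nra.
Qed.

Lemma hump_Q_le n j : N (Q n j) <= W (n + j).
Proof.
elim: j => [|j IH].
  rewrite /Q big_ord0 addn0 /W ler_peMr ?(sn_ge0 HN) //.
  elim/big_rec: _ => // i x _; have := sn_ge0 HN (c i); nra.
rewrite /Q big_ord_recr addnS /W big_ord_recr /= mulrA.
apply: le_trans (snM HN _ _) _; apply: ler_pM; rewrite ?(sn_ge0 HN) //.
by rewrite lerDr.
Qed.

(* The hump x_n is tested modulo (s - lam_n) B: there P_n (D x_n) is huge while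
   the later terms, which all contain the factor P_n (s - lam_n), contribute only
   D (P_(n+1)) times a bounded element. *)
Lemma gliding_hump : False.
Proof.
(* The summands after [p.1] absorb the earlier humps and the two terms in which [D] hits a product,
   using [N (x n) <= 1] and [N (Y n.+1) <= 2]; what is left is [n <= N (D (Y 0))]. *)
pose K (p : nat * B) :=
  p.1%:R + N (D p.2) + N (D (P p.1)) + 2 * N (D (P p.1.+1)).
have K0 p : 0 <= K p by rewrite !addr_ge0 ?mulr_ge0 ?(sn_ge0 HN).
have W0 m : 0 < W m := lt_le_trans ltr01 (hump_W_ge1 m).
have /choice [xi xiP] : forall p, exists x,
    N x <= 2^-1 ^+ p.1 / W p.1 /\ K p <= d p.1 (P p.1 * D x).
  by move=> p; apply: hump_big => //; rewrite divr_gt0 ?half_gt0.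
pose u n := iteri n (fun i w => w + P i * xi (i, w)) 0.
pose x n := xi (n, u n).
have Qx n j : N (Q n j * x (n + j)%N) <= 2^-1 ^+ j.
  apply: le_trans (snM HN _ _) _.
  have [+ _] := xiP ((n + j)%N, u (n + j)%N); rewrite /= -/(x _) => H.
  apply: le_trans (ler_pM (sn_ge0 HN _) (sn_ge0 HN _) (hump_Q_le n j) H) _.
  by rewrite mulrCA mulfV ?gt_eqF // mulr1 ler_wiXn2l ?leq_addl //; lra.
(* [Y n] is the tail series with terms [c n ... c (n + j - 1) * x (n + j)]; [Y 0] is the full sum of
   the humps. *)
have /choice [Y YP] n := bn_complete HB (Qx n).
have Yrec n : Y n = x n + c n * Y n.+1.
  apply/eqP; rewrite -subr_eq0; apply/eqP.
  apply: (@bn_half0 _ _ _ HB (2 + 2 * N (c n))) => j.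
  have H1 := YP n j.+1; have H2 := YP n.+1 j.
  have E : \sum_(i < j.+1) Q n i * x (n + i)%N =
      x n + c n * \sum_(i < j) Q n.+1 i * x (n.+1 + i)%N.
    rewrite big_ord_recl /Q big_ord0 mul1r addn0; congr (_ + _).
    rewrite mulr_sumr; apply: eq_bigr => i _.
    rewrite big_ord_recl /= addn0 -mulrA addnS addSn; congr (_ * (_ * _)).
    by apply: eq_bigr => k _; rewrite addnS addSn.
  rewrite E in H1.
  have -> : Y n - (x n + c n * Y n.+1) =
    (Y n - (x n + c n * \sum_(i < j) Q n.+1 i * x (n.+1 + i)%N))
     - c n * (Y n.+1 - \sum_(i < j) Q n.+1 i * x (n.+1 + i)%N) by ring.
  apply: le_trans (snB HN _ _) _; have := snM HN (c n) (Y n.+1 -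
    \sum_(i < j) Q n.+1 i * x (n.+1 + i)%N).
  have := ler_wpM2l (sn_ge0 HN (c n)) H2; have := half_gt0 R j.
  by rewrite exprS in H1; lra.
have Y0E n : Y 0%N = u n + P n * Y n.
  elim: n => [|n ->]; first by rewrite /u /P big_ord0 mul1r add0r.
  by rewrite (Yrec n) /P big_ord_recr /= -/(P n) -/(x n); ring.
have YN n : N (Y n) <= 2.
  by have := YP n 0%N; rewrite big_ord0 subr0 expr0 mulr1.
have large n : n%:R <= N (D (Y 0%N)).
  have [x1 x2] := xiP (n, u n); rewrite /= -/(x n) in x1 x2.
  have xle : N (x n) <= 1.
    apply: le_trans x1 _; rewrite ler_pdivrMr // mul1r.
    by apply: le_trans (hump_W_ge1 n); rewrite exprn_ile1 //; lra.
  have E : P n * D (x n) =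
     (D (Y 0%N) - D (u n) - D (P n) * x n - D (P n.+1) * Y n.+1) +
      c n * - (P n * D (Y n.+1)).
    have -> : P n.+1 = P n * c n by rewrite /P big_ord_recr.
    by rewrite (Y0E n) (Yrec n) linearD !DM linearD !DM; ring.
  move: x2; rewrite E /K /=; set Z := _ - _ - _ - _.
  have := snD (dS n) Z (c n * - (P n * D (Y n.+1))).
  rewrite [d n (c n * _)](dist_ideal HB) addr0.
  have := dist_le_norm HB (c n) Z; rewrite -/(d n _).
  have := snB HN (D (Y 0%N) - D (u n) - D (P n) * x n) (D (P n.+1) * Y n.+1).
  rewrite -/Z.
  have := snB HN (D (Y 0%N) - D (u n)) (D (P n) * x n).
  have := snB HN (D (Y 0%N)) (D (u n)).
  have := snM HN (D (P n)) (x n).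
  have := snM HN (D (P n.+1)) (Y n.+1).
  have := ler_wpM2l (sn_ge0 HN (D (P n))) xle.
  have := ler_wpM2l (sn_ge0 HN (D (P n.+1))) (YN n.+1).
  lra.
have := archi_boundP (sn_ge0 HN (D (Y 0%N))).
by rewrite ltNge large.
Qed.

End GlidingHump.

(** * Vanishing of the separating space and of the derivation *)

Lemma separating_finite_spectrum s : separating N D s ->
  exists rs : seq R[i], forall l, ~ invertible (s - l%:A) -> l \in rs.
Proof.
move=> sep_s; apply: contrapT => H.
have /choice [F FP] : forall rs : seq R[i], exists l,
    l \notin rs /\ ~ invertible (s - l%:A).
  move=> rs; apply: contrapT => H1; apply: H; exists rs => l nl.
  apply: contrapT => /negP lrs.
  by apply: H1; exists l.
(* Each new spectral value avoids its predecessors; starting from 0 keeps them all nonzero. *)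
pose L n := iter n (fun rs => F rs :: rs) [:: 0].
have inL n m : (n < m)%N -> F (L n) \in L m.
  elim: m => // m IH; rewrite ltnS leq_eqVlt => /orP[/eqP->|/IH].
    by rewrite inE eqxx.
  by move=> nm; rewrite inE nm orbT.
apply: (@gliding_hump s (fun n => F (L n)) sep_s).
- move=> n m; wlog nm : n m / (n <= m)%N.
    move=> W /esym E; case/orP: (leq_total n m) => /W;
      by [move/(_ (esym E))|move/(_ E)].
  move: nm; rewrite leq_eqVlt => /orP[/eqP//|/inL nm E].
  by have [] := FP (L m); rewrite -E nm.
- move=> n; have [+ _] := FP (L n); apply: contraNneq => ->.
  by elim: n => [|n IH]; rewrite inE ?eqxx // IH orbT.
- by move=> n; have [] := FP (L n).
Qed.

Lemma derivation_horner (s : B) (p : {poly R[i]}) :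
  D (horner_alg s p) = horner_alg s p^`() * D s.
Proof.
have D1 : D 1 = 0.
  have := DM 1 1; rewrite !mulr1 mul1r => /eqP.
  by rewrite -subr_eq0 opprD addrA subrr sub0r oppr_eq0 => /eqP.
elim/poly_ind: p => [|p l IH]; first by rewrite deriv0 !rmorph0 mul0r linear0.
rewrite derivD derivM derivX derivC addr0 mulr1 !(rmorphD, rmorphM) /=.
rewrite horner_algX horner_algC linearD DM IH linearZ /= D1 scaler0; ring.
Qed.

Hypothesis semisimple :
  forall x : B, (forall b : B, invertible (1 - b * x)) -> x = 0.

Lemma invertible_horner (s : B) (q : {poly R[i]}) : q != 0 ->
  (forall l, root q l -> invertible (s - l%:A)) -> invertible (horner_alg s q).
Proof.
move=> q0; have [rs E] := closed_field_poly_normal q => H.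
have {}H l : l \in rs -> invertible (s - l%:A).
  by move=> lrs; apply: H; rewrite E rootZ ?lead_coef_eq0 // root_prod_XsubC.
rewrite E linearZ /=; apply: invertibleM.
  by apply: invertibleZ; rewrite lead_coef_eq0.
rewrite rmorph_prod big_seq; elim/big_rec: _ => [|l x lrs IH].
  by exists 1; rewrite mulr1.
by apply: invertibleM => //; rewrite rmorphB /= horner_algX horner_algC; apply: H.
Qed.

Lemma derivation_separating_eq0 s : separating N D s -> D s = 0.
Proof.
move=> /separating_finite_spectrum[rs0 Hrs0].
(* Removing duplicates makes [p] separable; inserting 0 makes it nonconstant, so that [p - m] is
   never the zero polynomial. *)
pose rs := undup (0 :: rs0); have urs : uniq rs := undup_uniq _.
have Hrs l : ~ invertible (s - l%:A) -> l \in rs.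
  by move=> /Hrs0 lrs; rewrite mem_undup inE lrs orbT.
pose p : {poly R[i]} := \prod_(l <- rs) ('X - l%:P).
have ps0 : horner_alg s p = 0.
  (* Spectral mapping: for [m != 0] no root of [p - m] lies in [rs], which contains the spectrum of
     [s]. *)
  apply: semisimple => b; apply: (spectrum0_radical HB) => m m0.
  have -> : horner_alg s p - m%:A = horner_alg s (p - m%:P).
    by rewrite rmorphB /= horner_algC.
  apply: invertible_horner.
    have rs_gt0 : (0 < size rs)%N.
      by have : 0 \in rs; [rewrite mem_undup inE eqxx | case: (rs)].
    rewrite subr_eq0; apply/eqP => pm; have := size_polyC_leq1 m.
    by rewrite -pm /p (size_prod_XsubC rs id) ltnNge -ltnS ltnS rs_gt0.
  move=> l; rewrite rootE !hornerE subr_eq0 => /eqP pl; apply: contrapT => /Hrs.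
  by rewrite -root_prod_XsubC rootE pl (negPf m0).
have : separable_poly p by rewrite separable_prod_XsubC.
(* With [v p + w p' = 1], the relations [p(s) = 0] and [p'(s) D s = 0] give [D s = 0]. *)
rewrite separable_poly.unlock => /Bezout_eq1_coprimepP [[v w] /= E].
have := derivation_horner s p; rewrite ps0 linear0 => /esym E0.
have := congr1 (fun q => horner_alg s q * D s) E.
rewrite rmorph1 mul1r => <-.
by rewrite rmorphD !rmorphM /= ps0 mulr0 add0r -mulrA E0 mulr0.
Qed.

(* Where the separating space S is annihilated by D, S D(B) = 0 because
   S is an ideal, hence S S = 0 since S is contained in the closure of D(B). *)
Lemma separating_eq0 s : separating N D s -> s = 0.
Proof.
move=> sep_s.
have sep_mul x : separating N D (x * s).
  move=> e e0; pose M := N x + N (D x) + 1.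
  have x0 := sn_ge0 HN x; have Dx0 := sn_ge0 HN (D x).
  have M0 : 0 < M by rewrite /M; lra.
  have [y [y1 y2]] := sep_s _ (divr_gt0 e0 M0).
  have t0 : 0 < e / M by rewrite divr_gt0.
  have : e / M * M = e by rewrite divfK // gt_eqF.
  set t := e / M in t0 y1 y2 *; rewrite /M => eM.
  exists (x * y); split.
    apply: le_lt_trans (snM HN _ _) _; have := ler_wpM2l x0 (ltW y1).
    by have : 0 <= t * N (D x); [rewrite mulr_ge0 // ltW|lra].
  have -> : D (x * y) - x * s = D x * y + x * (D y - s) by rewrite DM; ring.
  apply: le_lt_trans (snD HN _ _) _.
  have := snM HN (D x) y; have := snM HN x (D y - s).
  have := ler_wpM2l x0 (ltW y2); have := ler_wpM2l Dx0 (ltW y1).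
  lra.
have sD x : s * D x = 0.
  have := derivation_separating_eq0 (sep_mul x); rewrite DM.
  by rewrite (derivation_separating_eq0 sep_s) mulr0 addr0 mulrC.
have ss0 : s * s = 0.
  apply: (bn_half0 HB (C := N s)) => n.
  have [x [_ x2]] := sep_s _ (half_gt0 R n).
  have -> : s * s = - (s * (D x - s)) by rewrite mulrBr sD; ring.
  rewrite (snN HN); apply: le_trans (snM HN _ _) _.
  by rewrite ler_wpM2l ?(sn_ge0 HN) // ltW.
apply: semisimple => b; exists (1 + b * s).
have -> : (1 + b * s) * (1 - b * s) = 1 - b * b * (s * s) by ring.
by rewrite ss0 mulr0 subr0.
Qed.

Theorem semisimple_derivation_eq0 x : D x = 0.
Proof.
have [K K0 DK] := closed_graph HB separating_eq0.
by apply: semisimple => b; apply: (bounded_derivation_radical K0 DK).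
Qed.

End Derivations.

(** * The corner defined by a right identity *)

Section Corner.
Variables (R : realType) (A : completeNormedModType R[i]).
Variables (mul : A -> A -> A) (e : A).
Hypothesis HA : banach_algebra mul.
Hypothesis Hrad : forall x : A, in_rad mul x <-> in_rann mul x.
Hypothesis Hcomm : forall a b : A, in_rad mul (commutator mul a b).
Hypothesis mule : forall a, mul a e = a.

Let mulA x y z : mul x (mul y z) = mul (mul x y) z := HA.1 x y z.
Let mulDl x y z : mul (x + y) z = mul x z + mul y z := HA.2.1 x y z.
Let mulDr x y z : mul x (y + z) = mul x y + mul x z := HA.2.2.1 x y z.
Let mulZl c x y : mul (c *: x) y = c *: mul x y := HA.2.2.2.1 c x y.
Let mulZr c x y : mul x (c *: y) = c *: mul x y := HA.2.2.2.2.1 c x y.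
Let normM x y : `|mul x y| <= `|x| * `|y| := HA.2.2.2.2.2 x y.

Lemma bmul0r x : mul x 0 = 0.
Proof. by rewrite -(scale0r (0 : A)) mulZr !scale0r. Qed.

Lemma bmul0l x : mul 0 x = 0.
Proof. by rewrite -(scale0r (0 : A)) mulZl !scale0r. Qed.

Lemma bmulNr x y : mul x (- y) = - mul x y.
Proof. by rewrite -scaleN1r mulZr scaleN1r. Qed.

Lemma bmulNl x y : mul (- x) y = - mul x y.
Proof. by rewrite -scaleN1r mulZl scaleN1r. Qed.

(** The norm of a module over [R[i]] takes its values in [R[i]]; being real, it is determined by its
    real part. *)
Definition rnorm (x : A) : R := complex.Re `|x|.

Lemma rnormE x : `|x| = (rnorm x)%:C.
Proof. by rewrite /rnorm RRe_real // normr_real. Qed.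

Lemma rnorm_ge0 x : 0 <= rnorm x.
Proof. by rewrite -lecR -rnormE normr_ge0. Qed.

Lemma rnormD x y : rnorm (x + y) <= rnorm x + rnorm y.
Proof. by rewrite -lecR rmorphD /= -!rnormE ler_normD. Qed.

Lemma rnormZ c x : rnorm (c *: x) = normc c * rnorm x.
Proof. by apply: complexI; rewrite rmorphM /= -!rnormE normrZ. Qed.

Lemma rnormM x y : rnorm (mul x y) <= rnorm x * rnorm y.
Proof. by rewrite -lecR rmorphM /= -!rnormE. Qed.

Lemma rnorm_eq0 x : rnorm x = 0 -> x = 0.
Proof. by move=> x0; apply/normr0_eq0; rewrite rnormE x0. Qed.

Lemma rnormN x : rnorm (- x) = rnorm x.
Proof. by rewrite /rnorm normrN. Qed.

Lemma rnorm_series (u : nat -> A) : (forall n, rnorm (u n) <= 2^-1 ^+ n) ->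
  exists l, forall n, rnorm (l - \sum_(i < n) u i) <= 2 * 2^-1 ^+ n.
Proof.
move=> uh; pose S n := \sum_(i < n) u i.
(* The subtracted term is what lets the induction on [k] close. *)
have tail n k : rnorm (S (k + n)%N - S n) <= 2 * 2^-1 ^+ n - 2 * 2^-1 ^+ (k + n).
  elim: k => [|k IH]; first by rewrite !subrr /rnorm normr0.
  have -> : S (k.+1 + n)%N - S n = (S (k + n)%N - S n) + u (k + n)%N.
    by rewrite /S addSn big_ord_recr /= addrAC.
  apply: le_trans (rnormD _ _) _; have := uh (k + n)%N.
  by rewrite addSn exprS; lra.
have tail2 n m : (n <= m)%N -> rnorm (S m - S n) <= 2 * 2^-1 ^+ n.
  move=> /subnK <-; apply: le_trans (tail _ _) _.
  by have := half_gt0 R (m - n + n); lra.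
have : cvg (S @ \oo)%classic.
  apply: cauchy_cvg; apply: cauchy_exP => eps eps0.
  have epsE : eps = (complex.Re eps)%:C by rewrite RRe_real // gtr0_real.
  have eps0' : 0 < complex.Re eps by rewrite -ltcR -epsE.
  have [n Hn] := @exists_half_lt R 2 _ (ler0n _ _) eps0'.
  exists (S n), n => // m /= nm; rewrite -ball_normE /ball_ /= rnormE epsE ltcR.
  by rewrite -rnormN opprB (le_lt_trans (tail2 _ _ nm)).
move=> /cvg_ex [l Sl]; exists l => n.
rewrite -subr_le0; apply: (@le0_of_half R _ 1) => k.
have k0 : 0 < (2^-1 ^+ k)%:C :> R[i] by rewrite ltcR half_gt0.
have /cvgrPdist_lt/(_ _ k0) [m _ Hm] := Sl.
have := Hm (maxn m n) (leq_maxl _ _); rewrite /= rnormE ltcR => H1.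
have H2 := tail2 _ _ (leq_maxr m n).
have := rnormD (l - S (maxn m n)) (S (maxn m n) - S n); rewrite subrKA.
by rewrite -/(S n); lra.
Qed.

Lemma right_id_idem : mul e e = e.
Proof. exact: mule. Qed.

Lemma rannP x : in_rann mul x <-> mul e x = 0.
Proof.
split=> [|ex0 a]; first exact.
by rewrite -(mule a) -mulA ex0 bmul0r.
Qed.

(** Commutators lie in the radical, which is the right annihilator, so [e] kills them from the
    left. *)
Lemma mule_comm x y : mul e (mul x y) = mul e (mul y x).
Proof.
have /Hrad/rannP := Hcomm x y; rewrite /commutator mulDr bmulNr => /eqP.
by rewrite subr_eq0 => /eqP.
Qed.

(** Since [e] is idempotent, this is [eA] written as a fixed-point set, from which closedness is
    readily checked. *)
Definition corner_pred : {pred A} := fun x => mul e x == x.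

Lemma corner_submod_closed : submod_closed corner_pred.
Proof.
split=> [|c x y]; first by rewrite unfold_in bmul0r.
by rewrite !unfold_in => /eqP ex /eqP ey; rewrite mulDr mulZr ex ey.
Qed.

HB.instance Definition _ := GRing.isSubmodClosed.Build R[i] A corner_pred
  corner_submod_closed.

Record corner := Corner { cval : A; cvalP : cval \in corner_pred }.
HB.instance Definition _ := [isSub for cval].
HB.instance Definition _ := [Choice of corner by <:].
HB.instance Definition _ := [SubChoice_isSubLmodule of corner by <:].

Lemma cval_inj : injective cval. Proof. exact: val_inj. Qed.

Lemma cvalE x : mul e (cval x) = cval x.
Proof. by case: x => x /= /eqP. Qed.

Lemma corner_mem x : mul e x \in corner_pred.
Proof. by rewrite unfold_in mulA right_id_idem. Qed.

Definition corner_of (x : A) : corner := Corner (corner_mem x).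

Definition corner_mul (x y : corner) : corner := corner_of (mul (cval x) (cval y)).

Lemma cval_mul x y : cval (corner_mul x y) = mul (cval x) (cval y).
Proof. by rewrite /= mulA cvalE. Qed.

Lemma corner_mulA : associative corner_mul.
Proof. by move=> x y z; apply: cval_inj; rewrite !cval_mul mulA. Qed.

Lemma corner_mulC : commutative corner_mul.
Proof. by move=> x y; apply: cval_inj; exact: mule_comm. Qed.

Lemma corner_mul1 : left_id (corner_of e) corner_mul.
Proof. by move=> x; apply: cval_inj; rewrite cval_mul /= right_id_idem cvalE. Qed.

Lemma corner_mulDl : left_distributive corner_mul +%R.
Proof. by move=> x y z; apply: cval_inj; rewrite /= -mulDr -mulDl. Qed.

Hypothesis e_neq0 : e != 0.

Lemma corner_one_neq0 : corner_of e != 0.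
Proof. by rewrite -val_eqE /= right_id_idem. Qed.

HB.instance Definition _ := GRing.Zmodule_isComNzRing.Build corner
  corner_mulA corner_mulC corner_mul1 corner_mulDl corner_one_neq0.

Lemma cvalM (x y : corner) : cval (x * y) = mul (cval x) (cval y).
Proof. exact: cval_mul. Qed.

Lemma corner_scalerAl (c : R[i]) (x y : corner) : c *: (x * y) = c *: x * y.
Proof. by apply: cval_inj; rewrite /= -mulZr -mulZl. Qed.

HB.instance Definition _ :=
  GRing.Lmodule_isLalgebra.Build R[i] corner corner_scalerAl.
HB.instance Definition _ := GRing.Lalgebra_isComAlgebra.Build R[i] corner.

Definition corner_norm (x : corner) : R := rnorm (cval x).

Lemma cval_sum n (u : nat -> corner) :
  cval (\sum_(i < n) u i) = \sum_(i < n) cval (u i).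
Proof. by elim: n => [|n IH]; rewrite ?big_ord0 // !big_ord_recr /= -IH. Qed.

Lemma corner_banach : banach_norm corner_norm.
Proof.
split=> [|x x0|u uh].
- split=> [x y|c x|x y]; [exact: rnormD|exact: rnormZ|].
  by rewrite /corner_norm cvalM rnormM.
- by apply: cval_inj; exact: rnorm_eq0.
- have [l Hl] := rnorm_series uh.
  have el : mul e l = l.
    apply/eqP; rewrite -subr_eq0; apply/eqP/rnorm_eq0/eqP.
    rewrite eq_le rnorm_ge0 andbT.
    apply: (@le0_of_half R _ (rnorm e * 2 + 2)) => n.
    have -> : mul e l - l = mul e (l - \sum_(i < n) cval (u i))
                             - (l - \sum_(i < n) cval (u i)).
      by rewrite mulDr bmulNr -cval_sum cvalE opprB addrA subrK.
    apply: le_trans (rnormD _ _) _; rewrite rnormN mulrDl lerD //.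
    by apply: le_trans (rnormM _ _) _; rewrite -mulrA ler_wpM2l ?rnorm_ge0.
  have lP : l \in corner_pred by apply/eqP.
  by exists (Corner lP) => n; rewrite /corner_norm /= cval_sum.
Qed.

(* The left quasi-inverse of b x in A is obtained from the inverse z of
   1 - (e b) x in the corner as - (b x) z. *)
Lemma corner_semisimple (x : corner) :
  (forall b : corner, invertible (1 - b * x)) -> x = 0.
Proof.
move=> Hx; have /Hrad/rannP : in_rad mul (cval x); last first.
  by rewrite cvalE => x0; apply: cval_inj.
move=> b; have [z /(congr1 cval)] := Hx (corner_of b).
rewrite cvalM /= right_id_idem !mulA right_id_idem -mulA; set bx := mul b (cval x).
rewrite mulDr mule bmulNr mulA mule => /eqP.
rewrite subr_eq addrC -subr_eq => /eqP zbx.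
exists (- mul bx (cval z)).
by rewrite bmulNl opprK -mulA -zbx mulDr bmulNr mule addrACA addNr add0r subrr.
Qed.

Variable d : A -> A.
Hypothesis Hd : derivation mul d.

Definition corner_der (x : corner) : corner := corner_of (d (cval x)).

Lemma corner_der_linear : linear corner_der.
Proof.
case: Hd => dD dZ _ c x y; apply: cval_inj.
by rewrite /= dD dZ mulDr mulZr.
Qed.

HB.instance Definition _ :=
  GRing.isLinear.Build R[i] corner corner *:%R corner_der corner_der_linear.

Lemma corner_derM (x y : corner) :
  corner_der (x * y) = corner_der x * y + x * corner_der y.
Proof.
case: Hd => _ _ dM; apply: cval_inj.
transitivity (mul (mul e (d (cval x))) (cval y) + mul (cval x) (mul e (d (cval y)))).
  by rewrite [mul (cval x) (mul e _)]mulA mule -{2}(cvalE x) -!mulA -mulDr -dM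
    -cvalM.
by rewrite -[mul e (d (cval x))]/(cval (corner_der x))
  -[mul e (d (cval y))]/(cval (corner_der y)) -!cvalM.
Qed.

Lemma corner_der_eq0 x : mul e (d (mul e x)) = 0.
Proof.
have := semisimple_derivation_eq0 corner_banach corner_derM corner_semisimple
  (corner_of x).
by move/(congr1 cval).
Qed.

End Corner.

(** * From the corner back to the whole algebra *)

Lemma derivation_in_rann (R : realType) (A : completeNormedModType R[i])
    (mul : A -> A -> A) (d : A -> A) (e : A) :
  banach_algebra mul -> (forall x, in_rad mul x <-> in_rann mul x) ->
  (forall a b, in_rad mul (commutator mul a b)) -> (forall a, mul a e = a) ->
  derivation mul d -> forall a, in_rann mul (d a).
Proof.
move=> HA Hrad Hcomm mule Hd a.
have [mulA [_ [mulDr _]]] := HA; have [dD _ dM] := Hd.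
have mul0 := bmul0r HA; have d0 : d 0 = 0.
  by have := dD 0 0; rewrite !addr0 => /eqP; rewrite -subr_eq subrr => /eqP.
(* If [e = 0] then [A] is zero; otherwise the corner is a nonzero ring. *)
have [e0|e0] := eqVneq e 0.
  by move=> x; rewrite -(mule (d a)) e0 mul0 mul0.
have ker x : in_rann mul x -> in_rann mul (d x).
  move=> x0 y; have := dM y x; rewrite !x0 d0 add0r => <- //.
apply/(rannP HA mule); rewrite -[a](subrKC (mul e a)) dD mulDr.
rewrite (corner_der_eq0 HA Hrad Hcomm mule e0 Hd) add0r; apply: ker => b.
by rewrite mulDr (bmulNr HA) mulA mule subrr.
Qed.

Theorem theorem4p1 (R : realType) (A : completeNormedModType R[i])
    (mul : A -> A -> A) (d : A -> A) (k : nat)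
    (HA : banach_algebra mul)
    (Hrad : forall x : A, in_rad mul x <-> in_rann mul x)
    (Hcomm : forall a b : A, in_rad mul (commutator mul a b))
    (Hrid : exists e : A, forall a : A, mul a e = a)
    (Hd : derivation mul d)
    (Hk : (0 < k)%N) :
  [/\ (d = (fun _ => 0)) <-> k_centralizing mul k d,
      k_centralizing mul k d <-> k_commuting mul k d
    & k_commuting mul k d <-> d = (fun _ => 0)].
Proof.
have [e mule] := Hrid; have [mulA [mulDl [mulDr _]]] := HA.
have dr := derivation_in_rann HA Hrad Hcomm mule Hd.
have commE a : commutator mul (d a) (powk mul a k) = mul (d a) (powk mul a k).
  by rewrite /commutator dr subr0.
have zero_comm : d = (fun _ => 0) -> k_commuting mul k d.
  by move=> d0 a; rewrite commE d0 (bmul0l HA).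
have comm_cent : k_commuting mul k d -> k_centralizing mul k d.
  by move=> H a b; rewrite H (bmul0l HA) (bmul0r HA).
have cent_comm : k_centralizing mul k d -> k_commuting mul k d.
  move=> H a; have := H a e; rewrite commE mule => ->.
  by rewrite mulA dr (bmul0l HA).
have comm_zero : k_commuting mul k d -> d = (fun _ => 0).
  move=> H; have idem a : mul a a = a -> mul (d a) a = 0.
    move=> aa; have pwE n : pw mul a n = a by elim: n => //= n ->.
    by have := H a; rewrite commE /powk pwE.
  have [dD _ dM] := Hd.
  have de : d e = 0 by rewrite -[d e]mule; apply: idem; apply: mule.
  (* The idempotent [e + n] gives [0 = d (e + n) (e + n) = d (e + n) e = d n]. *)
  have dn n : in_rann mul n -> d n = 0.
    move=> n0; have : mul (d (e + n)) (e + n) = 0.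
      by apply: idem; rewrite mulDr n0 addr0 mule.
    by rewrite mulDr n0 addr0 mule dD de add0r.
  apply/funext => a; rewrite -[a](subrKC (mul e a)) dD dM de (bmul0l HA) dr
    addr0 add0r.
  by apply: dn => b; rewrite mulDr (bmulNr HA) mulA mule subrr.
by split; split; auto.
Qed.
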